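(* Let $\mathbb{F}_q$ be a finite field of odd characteristic and let $\epsilon,\delta\in\mathbb{F}_q$ with $\epsilon(\delta^2-\epsilon)\neq 0$ and $\chi(\epsilon)=1$. Fix a square root $\sqrt{\epsilon}\in\mathbb{F}_q$. Then the Jacobi quartic curve $J_{\epsilon,\delta}: y^2=\epsilon x^4+2\delta x^2+1$ over $\mathbb{F}_q$ has dADD-M formulas with the function $$w(x,y)=2(\delta-\sqrt{\epsilon})\,\frac{x^2(1-\sqrt{\epsilon}\,x^2)^2}{y^2(1+\sqrt{\epsilon}\,x^2)^2}$$ and $e=\dfrac{4(\delta+\sqrt{\epsilon})}{\delta-\sqrt{\epsilon}}$; that is, $w$ is an inverted Montgomery-like function on $J_{\epsilon,\delta}$ with parameter $e$.
   Context: $\chi$ is the quadratic character of $\mathbb{F}_q$: for $a\ne0$, $\chi(a)=1$ if $a$ is a square in $\mathbb{F}_q$ and $\chi(a)=-1$ otherwise. The Jacobi quartic curve $J_{\epsilon,\delta}$ is regarded as an elliptic curve through its smooth projective model $X^2=TZ$, $Y^2=\epsilon T^2+2\delta X^2+Z^2$ in $\mathbb{P}^3$ with coordinates $(X:Y:T:Z)$, the affine point $(x,y)$ being $(x:y:x^2:1)$; the points with $Z=0$ are $(0:\pm\sqrt{\epsilon}:1:0)$. The identity is $(0,1)$, $-(x,y)=(-x,y)$, and addition is generically $$(x_1,y_1)+(x_2,y_2)=\left(\frac{x_1y_2+x_2y_1}{1-\epsilon x_1^2x_2^2},\ \frac{(y_1y_2+2\delta x_1x_2)(1+\epsilon x_1^2x_2^2)+2\epsilon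 x_1x_2(x_1^2+x_2^2)}{(1-\epsilon x_1^2x_2^2)^2}\right).$$ Inverted Montgomery-like function: let $E$ be an elliptic curve over a field $\mathbb{F}$ of characteristic $\neq2$ and $w$ a rational function on $E$ with $w(P)=w(-P)$ for all $P$. View $w(P)$ in $\mathbb{P}^1(\mathbb{F})$ as $(w(P):1)$ if $w$ is regular at $P$ and $(1:0)$ otherwise. For $P_1,P_2\in E(\mathbb{F})$ put $(W_0:Z_0)=w(P_2-P_1)$, $(W_1:Z_1)=w(P_1)$, $(W_2:Z_2)=w(P_2)$, $(W_3:Z_3)=w(P_1+P_2)$, $(W_4:Z_4)=w(2P_1)$. Then $w$ is an inverted Montgomery-like function with parameter $e\in\mathbb{F}$ if for all $P_1,P_2\in E(\mathbb{F})$ with $W_0Z_0\neq0$, $$(W_4:Z_4)=\big(4W_1Z_1((W_1+Z_1)^2-eW_1Z_1):(W_1^2-Z_1^2)^2\big),$$ $$(W_3:Z_3)=\big(Z_0(W_1Z_2-W_2Z_1)^2:W_0(W_1W_2-Z_1Z_2)^2\big).$$ (Equivalently $1/w$ is a Montgomery-like function, given by the same formulas with the two coordinates swapped; a curve with such a function is said to have dADD-M formulas.) *)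

(* Defs.v *)
From HB Require Import structures.
From mathcomp Require Import all_boot all_order all_algebra.
From mathcomp Require Import mpoly ring.

Set Implicit Arguments.
Unset Strict Implicit.
Unset Printing Implicit Defensive.

Import GRing.Theory.
Local Open Scope ring_scope.

(* Only the values at a != 0 matter; the value at 0 is the usual convention. *)
Definition quadratic_char (F : finFieldType) (a : F) : int :=
  if a == 0 then 0 else if [exists b : F, b ^+ 2 == a] then 1 else - 1.

Definition iX : 'I_4 := @Ordinal 4 0 isT.
Definition iY : 'I_4 := @Ordinal 4 1 isT.
Definition iT : 'I_4 := @Ordinal 4 2 isT.
Definition iZ : 'I_4 := @Ordinal 4 3 isT.

Definition hpoint (F : fieldType) (x y t z : F) : 'rV[F]_4 :=
  \row_(i < 4) [:: x; y; t; z]`_i.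

(* Points of P^3 are handled through homogeneous coordinate vectors; everything
   below is invariant under scaling them. *)
Definition on_jacobi_quartic (F : fieldType) (eps delta : F) (P : 'rV[F]_4) :=
  [&& P != 0,
      P 0 iX ^+ 2 == P 0 iT * P 0 iZ
    & P 0 iY ^+ 2 ==
        eps * P 0 iT ^+ 2 + 2 * delta * P 0 iX ^+ 2 + P 0 iZ ^+ 2].

Section GroupLaw.
Variables (F : fieldType) (eps delta : F).
Implicit Types P Q : 'rV[F]_4.

Definition jq_zero : 'rV[F]_4 := hpoint 0 1 0 1.

Definition jq_opp P : 'rV[F]_4 :=
  hpoint (- P 0 iX) (P 0 iY) (P 0 iT) (P 0 iZ).

(* The generic addition formula with x = X/Z, y = Y/Z, x^2 = T/Z and the
   denominators cleared (see jq_law_affine). *)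
Definition jq_law P Q : 'rV[F]_4 :=
  let: (X1, Y1, T1, Z1) := (P 0 iX, P 0 iY, P 0 iT, P 0 iZ) in
  let: (X2, Y2, T2, Z2) := (Q 0 iX, Q 0 iY, Q 0 iT, Q 0 iZ) in
  let N := X1 * Y2 + X2 * Y1 in
  let D := Z1 * Z2 - eps * T1 * T2 in
  hpoint (N * D)
         ((Y1 * Y2 + 2 * delta * X1 * X2) * (Z1 * Z2 + eps * T1 * T2)
            + 2 * eps * X1 * X2 * (T1 * Z2 + T2 * Z1))
         (N ^+ 2) (D ^+ 2).

(* A second bihomogeneous representation of the same morphism J x J -> J, for
   the pairs at which all the coordinates of jq_law vanish: the two agree
   wherever both are defined (jq_laws_agree), and they never vanish together
   (jq_laws_complete). *)
Definition jq_law_dual P Q : 'rV[F]_4 :=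
  let: (X1, Y1, T1, Z1) := (P 0 iX, P 0 iY, P 0 iT, P 0 iZ) in
  let: (X2, Y2, T2, Z2) := (Q 0 iX, Q 0 iY, Q 0 iT, Q 0 iZ) in
  let N := T1 * Z2 - T2 * Z1 in
  let D := X1 * Y2 - X2 * Y1 in
  hpoint (N * D)
         ((Y1 * Y2 - 2 * delta * X1 * X2) * (T1 * Z2 + T2 * Z1)
            - 2 * X1 * X2 * (Z1 * Z2 + eps * T1 * T2))
         (N ^+ 2) (D ^+ 2).

Definition jq_add P Q : 'rV[F]_4 :=
  if jq_law P Q != 0 then jq_law P Q else jq_law_dual P Q.

Lemma hpointE (x y t z : F) :
  (hpoint x y t z 0 iX = x) * (hpoint x y t z 0 iY = y) *
  (hpoint x y t z 0 iT = t) * (hpoint x y t z 0 iZ = z).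
Proof. by rewrite !mxE. Qed.

Lemma rV4P P Q : P 0 iX = Q 0 iX -> P 0 iY = Q 0 iY -> P 0 iT = Q 0 iT ->
  P 0 iZ = Q 0 iZ -> P = Q.
Proof.
move=> hX hY hT hZ; apply/rowP => -[[|[|[|[|//]]]] lti].
- by rewrite (_ : Ordinal lti = iX) //; apply: val_inj.
- by rewrite (_ : Ordinal lti = iY) //; apply: val_inj.
- by rewrite (_ : Ordinal lti = iT) //; apply: val_inj.
- by rewrite (_ : Ordinal lti = iZ) //; apply: val_inj.
Qed.

Lemma hpoint_eq0 (x y t z : F) :
  (hpoint x y t z == 0) = [&& x == 0, y == 0, t == 0 & z == 0].
Proof.
apply/eqP/and4P => [/rowP h|[/eqP-> /eqP-> /eqP-> /eqP->]].
  by have [] := And4 (h iX) (h iY) (h iT) (h iZ); rewrite !mxE /= => -> -> -> ->.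
by apply: rV4P; rewrite !hpointE mxE.
Qed.

Lemma jq_law_affine (x1 y1 x2 y2 : F) : 1 - eps * x1 ^+ 2 * x2 ^+ 2 != 0 ->
  let d := 1 - eps * x1 ^+ 2 * x2 ^+ 2 in
  let x3 := (x1 * y2 + x2 * y1) / d in
  let y3 := ((y1 * y2 + 2 * delta * x1 * x2) * (1 + eps * x1 ^+ 2 * x2 ^+ 2)
              + 2 * eps * x1 * x2 * (x1 ^+ 2 + x2 ^+ 2)) / d ^+ 2 in
  jq_add (hpoint x1 y1 (x1 ^+ 2) 1) (hpoint x2 y2 (x2 ^+ 2) 1)
    = d ^+ 2 *: hpoint x3 y3 (x3 ^+ 2) 1.
Proof.
move=> d0 d x3 y3; have -> P Q : jq_law P Q 0 iZ != 0 -> jq_add P Q = jq_law P Q.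
  move=> h; rewrite /jq_add ifT //; apply: contraNneq h => ->.
  by rewrite mxE.
- by rewrite /jq_law !hpointE; apply: rV4P; rewrite !mxE /= /x3 /y3 /d; field.
- by rewrite /jq_law !hpointE sqrf_eq0 !mulr1.
Qed.

Lemma jq_laws_agree P Q i j :
    on_jacobi_quartic eps delta P -> on_jacobi_quartic eps delta Q ->
  jq_law P Q 0 i * jq_law_dual P Q 0 j = jq_law P Q 0 j * jq_law_dual P Q 0 i.
Proof.
case/and3P=> _ /eqP hX1 /eqP hY1 /and3P[_ /eqP hX2 /eqP hY2].
rewrite /jq_law /jq_law_dual.
move: hX1 hY1 hX2 hY2.
move: (P 0 iX) (P 0 iY) (P 0 iT) (P 0 iZ) => X1 Y1 T1 Z1.
move: (Q 0 iX) (Q 0 iY) (Q 0 iT) (Q 0 iZ) => X2 Y2 T2 Z2 hX1 hY1 hX2 hY2.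
rewrite hX1 in hY1; rewrite hX2 in hY2.
case: i j => [[|[|[|[|//]]]] lti] [[|[|[|[|//]]]] ltj]; rewrite !mxE /=;
  ring: hX1 hY1 hX2 hY2.
Qed.

Hypotheses (charF : 2%N \notin [pchar F]) (nsing : eps * (delta ^+ 2 - eps) != 0).

Lemma two_neq0 : (2 : F) != 0.
Proof. by apply: contra charF => h; rewrite inE. Qed.

Lemma jq_laws_complete P Q :
    on_jacobi_quartic eps delta P -> on_jacobi_quartic eps delta Q ->
  ~~ ((jq_law P Q == 0) && (jq_law_dual P Q == 0)).
Proof.
have nz (R : 'rV[F]_4) : on_jacobi_quartic eps delta R ->
    R 0 iT = 0 -> R 0 iZ != 0.
  case/and3P=> R0 /eqP hX /eqP hY hT; apply: contraNneq R0 => hZ; apply/eqP.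
  have /eqP hX0 : R 0 iX ^+ 2 == 0 by rewrite hX hT mul0r.
  have hY0 : R 0 iY ^+ 2 == 0.
    by rewrite hY hX0 hT hZ expr0n /= !mulr0 !addr0.
  by apply: rV4P; rewrite mxE //; apply/eqP; rewrite -sqrf_eq0 ?hX0.
move=> hP hQ; move: (nz P hP) (nz Q hQ) => {nz}.
case/and3P: hP hQ => _ /eqP hX1 /eqP hY1 /and3P[_ /eqP hX2 /eqP hY2].
move: hX1 hY1 hX2 hY2; rewrite /jq_law /jq_law_dual.
move: (P 0 iX) (P 0 iY) (P 0 iT) (P 0 iZ) => X1 Y1 T1 Z1.
move: (Q 0 iX) (Q 0 iY) (Q 0 iT) (Q 0 iZ) => X2 Y2 T2 Z2 hX1 hY1 hX2 hY2 n1 n2.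
rewrite !hpoint_eq0 !sqrf_eq0.
apply/andP => -[/and4P[_ _ /eqP hN /eqP hD] /and4P[_ _ /eqP hN' /eqP hD']].
have [e0 de] : eps != 0 /\ delta ^+ 2 - eps != 0.
  by apply/andP; rewrite -negb_or -mulf_eq0.
have ZZ : Z1 * Z2 = eps * T1 * T2 by apply: subr0_eq.
have TZ : T2 * Z1 = T1 * Z2 by apply/esym/subr0_eq.
have T10 : T1 != 0.
  apply/eqP => h; have z1 := n1 h.
  have T20 : T2 = 0.
    by apply: (mulIf z1); rewrite TZ h !mul0r.
  by case/negP: (n2 T20); rewrite -(mulrI_eq0 _ (mulfI z1)) ZZ h mulr0 mul0r.
have Z20 : Z2 != 0.
  apply/eqP => h; have : eps * T1 * T2 == 0 by rewrite -ZZ h mulr0.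
  rewrite !mulf_eq0 (negPf e0) (negPf T10) /= => /eqP T20.
  by case/eqP: (n2 T20).
have T20 : T2 != 0.
  by apply: contraNneq (mulf_neq0 T10 Z20) => h; rewrite -TZ h mul0r.
have X20 : X2 != 0 by rewrite -sqrf_eq0 hX2 mulf_neq0.
have Y10 : Y1 = 0.
  apply: (mulfI (mulf_neq0 two_neq0 X20)); rewrite mulr0.
  by rewrite -[RHS]hN -[LHS]addr0 -[in LHS]hD'; ring.
have Z12 : Z1 ^+ 2 = eps * T1 ^+ 2.
  apply: (mulIf Z20); rewrite expr2 -mulrA ZZ.
  have -> : Z1 * (eps * T1 * T2) = eps * T1 * (T2 * Z1) by ring.
  by rewrite TZ; ring.
have Z1E : Z1 = - delta * T1.
  have Z10 : Z1 != 0 by rewrite -sqrf_eq0 Z12 mulf_neq0 // sqrf_eq0.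
  apply: (mulfI (mulf_neq0 two_neq0 Z10)).
  move: hY1; rewrite Y10 hX1 -Z12 expr0n /= => hY1.
  by apply/eqP; rewrite -subr_eq0; apply/eqP; rewrite [RHS]hY1; ring.
case/negP: (mulf_neq0 de (mulf_neq0 T10 T10)).
by apply/eqP; move: Z12; rewrite Z1E => h; ring: h.
Qed.

Lemma jq_add_on P Q :
    on_jacobi_quartic eps delta P -> on_jacobi_quartic eps delta Q ->
  on_jacobi_quartic eps delta (jq_add P Q).
Proof.
move=> hP hQ; apply/and3P; split.
- have := jq_laws_complete hP hQ; rewrite negb_and /jq_add.
  by case: (boolP (jq_law P Q == 0)) => //=.
- by rewrite /jq_add /jq_law /jq_law_dual; case: ifP => _;
    rewrite !hpointE exprMn.
- case/and3P: hP hQ => _ /eqP hX1 /eqP hY1 /and3P[_ /eqP hX2 /eqP hY2].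
  apply/eqP; rewrite /jq_add /jq_law /jq_law_dual; case: ifP => _.
  all: rewrite !hpointE; move: hX1 hY1 hX2 hY2.
  all: move: (P 0 iX) (P 0 iY) (P 0 iT) (P 0 iZ) => X1 Y1 T1 Z1.
  all: move: (Q 0 iX) (Q 0 iY) (Q 0 iT) (Q 0 iZ) => X2 Y2 T2 Z2.
  all: move=> hX1 hY1 hX2 hY2; rewrite hX1 in hY1; rewrite hX2 in hY2.
  all: ring: hX1 hY1 hX2 hY2.
Qed.

End GroupLaw.

(* Equality in P^1(F); both pairs are required to be homogeneous coordinates of
   a point, i.e. not (0, 0). *)
Definition proj1_eq (F : fieldType) (u v : F * F) : Prop :=
  [/\ u != (0, 0), v != (0, 0) & u.1 * v.2 = v.1 * u.2].

Section RationalFunctions.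
Variables (F : fieldType) (eps delta : F).
Implicit Types (w : {mpoly F[4]} * {mpoly F[4]}) (P : 'rV[F]_4).

(* The homogeneous ideal of the curve. *)
Definition jq_ideal (p : {mpoly F[4]}) : Prop :=
  exists a b : {mpoly F[4]},
    p = a * ('X_iX ^+ 2 - 'X_iT * 'X_iZ)
        + b * ('X_iY ^+ 2 - (eps%:MP * 'X_iT ^+ 2
                             + (2 * delta)%:MP * 'X_iX ^+ 2 + 'X_iZ ^+ 2)).

(* A rational function on the curve is presented by a fraction w.1 / w.2 of
   forms of the same degree whose denominator is not identically 0 on it. *)
Definition is_ratfun w : Prop :=
  (exists d : nat, w.1 \is d.-homog /\ w.2 \is d.-homog) /\ ~ jq_ideal w.2.

(* w is regular at P with value a: some fraction A / B equal to w in the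
   function field has B(P) != 0, and then a = A(P) / B(P). *)
Definition regular_value w P (a : F) : Prop :=
  exists (A B : {mpoly F[4]}) (d : nat),
    [/\ A \is d.-homog, B \is d.-homog, jq_ideal (A * w.2 - w.1 * B),
        B.@[P 0] != 0 & a = A.@[P 0] / B.@[P 0]].

(* v is a pair of homogeneous coordinates of w(P) in P^1(F). *)
Definition ratfun_value w P (v : F * F) : Prop :=
  (exists2 a : F, regular_value w P a & proj1_eq v (a, 1))
  \/ ((~ exists a : F, regular_value w P a) /\ proj1_eq v (1, 0)).

End RationalFunctions.

(* w(P) = w(-P) for all the geometric points P of the curve: over a finite
   field the rational points would not suffice to make w an even function. *)
Definition even_ratfun (F : fieldType) (eps delta : F)
    (w : {mpoly F[4]} * {mpoly F[4]}) : Prop :=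
  forall (K : fieldType) (f : {rmorphism F -> K}) (P : 'rV[K]_4) (u v : K * K),
    let wK := (map_mpoly f w.1, map_mpoly f w.2) in
    on_jacobi_quartic (f eps) (f delta) P ->
    ratfun_value (f eps) (f delta) wK P u ->
    ratfun_value (f eps) (f delta) wK (jq_opp P) v ->
    proj1_eq u v.

Definition inverted_montgomery_like (F : fieldType) (eps delta : F)
    (w : {mpoly F[4]} * {mpoly F[4]}) (e : F) : Prop :=
  [/\ is_ratfun eps delta w,
      even_ratfun eps delta w
    & forall (P1 P2 : 'rV[F]_4) (W0 Z0 W1 Z1 W2 Z2 W3 Z3 W4 Z4 : F),
        let add := jq_add eps delta in
        let value := ratfun_value eps delta w in
        on_jacobi_quartic eps delta P1 ->
        on_jacobi_quartic eps delta P2 ->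
        value (add P2 (jq_opp P1)) (W0, Z0) ->
        value P1 (W1, Z1) ->
        value P2 (W2, Z2) ->
        value (add P1 P2) (W3, Z3) ->
        value (add P1 P1) (W4, Z4) ->
        W0 * Z0 != 0 ->
        proj1_eq (W4, Z4)
          (4 * W1 * Z1 * ((W1 + Z1) ^+ 2 - e * W1 * Z1),
           (W1 ^+ 2 - Z1 ^+ 2) ^+ 2)
        /\
        proj1_eq (W3, Z3)
          (Z0 * (W1 * Z2 - W2 * Z1) ^+ 2, W0 * (W1 * W2 - Z1 * Z2) ^+ 2)].

(* s stands for the chosen square root of eps; x = X/Z, y = Y/Z, x^2 = T/Z. *)
Definition jq_w (F : fieldType) (delta s : F) : {mpoly F[4]} * {mpoly F[4]} :=
  ((2 * (delta - s))%:MP * 'X_iX ^+ 2 * ('X_iZ - s%:MP * 'X_iT) ^+ 2,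
   'X_iY ^+ 2 * ('X_iZ + s%:MP * 'X_iT) ^+ 2).

Lemma jq_w_affine (F : fieldType) (delta s x y : F) :
  let P := hpoint x y (x ^+ 2) 1 in
  (jq_w delta s).1.@[P 0] / (jq_w delta s).2.@[P 0]
    = 2 * (delta - s) * (x ^+ 2 * (1 - s * x ^+ 2) ^+ 2
                         / (y ^+ 2 * (1 + s * x ^+ 2) ^+ 2)).
Proof.
move=> P; rewrite /jq_w /= !expr2 !mevalM mevalB mevalD !mevalM !mevalC.
by rewrite !mevalXU !hpointE !mulrA.
Qed.

(* Main.v *)
Require Import Defs.
From mathcomp Require Import all_boot all_order all_algebra.
From mathcomp Require Import mpoly ring.

Set Implicit Arguments.
Unset Strict Implicit.
Unset Printing Implicit Defensive.

Import GRing.Theory.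
Local Open Scope ring_scope.

(** Put kappa = 2 (delta - s).  The function of the theorem is kappa f^2 with
    f = x (1 - s x^2) / (y (1 + s x^2)), and f is the first coordinate of an
    isogeny onto another Jacobi quartic: with a suitable second coordinate g,
      g^2 = kappa^2 f^4 - 4 (delta + 3 s) f^2 + 1.
    The identities of the first coordinate on such a quartic,
      f(2P) = 2 f(P) g(P) / (1 - kappa^2 f(P)^4),
      f(P+Q) f(Q-P) = (f(Q)^2 - f(P)^2) / (1 - kappa^2 f(P)^2 f(Q)^2),
    become, after squaring and putting w = kappa f^2, the doubling and the
    differential addition formulas; the parameter e comes from
      g^2 = (kappa f^2 + 1)^2 - 8 (delta + s) f^2.

    In homogeneous coordinates f is the quotient of the forms
    jq_f_num = X (Z - sT) and jq_f_den = Y (Z + sT), and the two identities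
    are checked on numerators and denominators, as congruences modulo the
    equations of the curve (jq_f_num_add_sub, jq_f_den_add_sub,
    jq_f_num_double, jq_f_den_double).  A cofactor in these congruences may
    vanish at some points; this does no harm, since numerator and denominator
    have the same one and it enters both sides of an equality in P^1 alike.

    Two facts turn the congruences into statements about w at every rational
    point.  The forms jq_f_num and jq_f_den have no common zero on the curve
    (jq_f_neq00), so that the given fraction computes the value of w in P^1
    everywhere, points at infinity and poles included (jq_w_value).  And if
    w(Q - P) is not 0, then the first addition law is defined at (P, Q)
    (jq_law_neq0), whereas Q - P may have to be computed by either law. *)

(** * The function w as a fraction without base points *)

Definition jq_f_num (F : fieldType) (s : F) (P : 'rV[F]_4) : F :=
  P 0 iX * (P 0 iZ - s * P 0 iT).

Definition jq_f_den (F : fieldType) (s : F) (P : 'rV[F]_4) : F :=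
  P 0 iY * (P 0 iZ + s * P 0 iT).

Lemma jq_w_num (F : fieldType) (delta s : F) (P : 'rV[F]_4) :
  (jq_w delta s).1.@[P 0] = 2 * (delta - s) * jq_f_num s P ^+ 2.
Proof.
rewrite /jq_w /jq_f_num /= !expr2 !mevalM mevalB !mevalM !mevalC !mevalXU; ring.
Qed.

Lemma jq_w_den (F : fieldType) (delta s : F) (P : 'rV[F]_4) :
  (jq_w delta s).2.@[P 0] = jq_f_den s P ^+ 2.
Proof.
rewrite /jq_w /jq_f_den /= !expr2 !mevalM mevalD !mevalM !mevalC !mevalXU; ring.
Qed.

Lemma map_jq_w (F K : fieldType) (f : {rmorphism F -> K}) (delta s : F) :
  (map_mpoly f (jq_w delta s).1, map_mpoly f (jq_w delta s).2)
    = jq_w (f delta) (f s).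
Proof.
rewrite /jq_w /= !(rmorphM, rmorphB, rmorphD, rmorphXn) /=.
by rewrite !map_mpolyC !map_mpolyX /= (rmorph1 f).
Qed.

Lemma jq_w_homog (F : fieldType) (delta s : F) :
  (jq_w delta s).1 \is 4.-homog /\ (jq_w delta s).2 \is 4.-homog.
Proof.
have homX (i : 'I_4) : ('X_i : {mpoly F[4]}) \is 1.-homog.
  by rewrite dhomogX /= mdeg1.
have homCX (c : F) (i : 'I_4) : (c%:MP * 'X_i : {mpoly F[4]}) \is 1.-homog.
  by rewrite mul_mpolyC dhomogZ.
have homC (c : F) : (c%:MP : {mpoly F[4]}) \is 0.-homog.
  by rewrite -[c%:MP]mulr1 mul_mpolyC dhomogZ ?dhomog1.
have sq (l : {mpoly F[4]}) d : l \is d.-homog -> l ^+ 2 \is (d * 2).-homog.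
  exact: dhomogMn.
split.
  apply: (@dhomogM _ _ _ (0 + 2) _ 2).
    by apply: (@dhomogM _ _ _ 0 _ 2); [exact: homC | exact: (sq _ 1)].
  by apply: (sq _ 1); apply: rpredB; [exact: homX | exact: homCX].
apply: (@dhomogM _ _ _ (0 + 2) _ 2); first exact: (sq _ 1).
by apply: (sq _ 1); apply: rpredD; [exact: homX | exact: homCX].
Qed.

Lemma jq_ideal_eval0 (F : fieldType) (eps delta : F) p (P : 'rV[F]_4) :
  jq_ideal eps delta p -> on_jacobi_quartic eps delta P -> p.@[P 0] = 0.
Proof.
case=> a [b ->] /and3P[_ /eqP hX /eqP hY].
rewrite !expr2 mevalD !(mevalM, mevalB, mevalD) !mevalC !mevalXU -!expr2 hY hX.
by ring.
Qed.

(** A fraction A / B equal to w = w.1 / w.2 satisfies A w.2 = w.1 B on the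
    curve, hence also at P, even when w.2 vanishes there; since w.1 and w.2 do
    not both vanish, this leaves only one possible value.  In particular, w is
    not regular at P exactly when w.2(P) = 0. *)
Lemma ratfun_value_base_point_free (F : fieldType) (eps delta : F) w d
    (P : 'rV[F]_4) v :
    w.1 \is d.-homog -> w.2 \is d.-homog ->
    on_jacobi_quartic eps delta P -> (w.1.@[P 0], w.2.@[P 0]) != (0, 0) ->
  ratfun_value eps delta w P v -> proj1_eq v (w.1.@[P 0], w.2.@[P 0]).
Proof.
move=> hom1 hom2 onP w0 [[a [A [B [dAB [_ _ idAB B0 ->]]]]] | [irreg]].
  case=> v0 _ /=; rewrite mulr1 => vE; split=> //=.
  have /eqP := jq_ideal_eval0 idAB onP.
  rewrite mevalB !mevalM subr_eq0 => /eqP ABw.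
  apply: (mulIf B0); rewrite vE [RHS]mulrAC -ABw; field; exact: B0.
case=> v0 _ /=; rewrite mulr0 mul1r => v20; split=> //=.
suff -> : w.2.@[P 0] = 0 by rewrite -v20 !mulr0.
apply/eqP/contraT => w20; case: irreg.
exists (w.1.@[P 0] / w.2.@[P 0]), w.1, w.2, d; split=> //.
by exists 0, 0; rewrite subrr !mul0r addr0.
Qed.

Lemma proj1_eq_scale (F : fieldType) (u v : F * F) :
  proj1_eq u v -> exists2 l : F, l != 0 & u = (l * v.1, l * v.2).
Proof.
case: u v => [u1 u2] [v1 v2] [/= u0 v0 uv].
have [v20|v20] := eqVneq v2 0.
  have v10 : v1 != 0 by apply: contraNneq v0 => ->; rewrite v20.
  have u20 : u2 = 0 by apply: (mulfI v10); rewrite -uv v20 !mulr0.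
  exists (u1 / v1); last by rewrite u20 v20 mulr0 divfK.
  by rewrite mulf_neq0 ?invr_neq0 //; apply: contraNneq u0 => ->; rewrite u20.
have u1E : u1 = u2 / v2 * v1 by rewrite mulrAC [u2 * v1]mulrC -uv mulfK.
exists (u2 / v2); last by rewrite -u1E divfK.
rewrite mulf_neq0 ?invr_neq0 //; apply: contraNneq u0 => u20.
by rewrite u1E u20 !mul0r.
Qed.

Lemma proj1_eq_common (F : fieldType) (u v t : F * F) :
  proj1_eq u t -> proj1_eq v t -> proj1_eq u v.
Proof.
case=> u0 _ ut /[dup] [[v0 _ _]] /proj1_eq_scale[l _ vE].
by split=> //; rewrite vE /= mulrCA ut mulrA.
Qed.

Lemma sq_pair_neq0 (F : fieldType) (k l a b : F) :
  k != 0 -> l != 0 -> (a, b) != (0, 0) ->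
  (l * (k * a ^+ 2), l * b ^+ 2) != (0, 0).
Proof.
move=> k0 l0.
by rewrite !xpair_eqE !mulf_eq0 (negPf k0) (negPf l0) /= !orbb.
Qed.

Lemma jq_opp_on (F : fieldType) (eps delta : F) (P : 'rV[F]_4) :
  on_jacobi_quartic eps delta P -> on_jacobi_quartic eps delta (jq_opp P).
Proof.
case/and3P=> P0 hX hY; rewrite /on_jacobi_quartic /jq_opp !hpointE !sqrrN.
rewrite hX hY !andbT; apply: contraNneq P0.
move/eqP; rewrite hpoint_eq0 oppr_eq0 => /and4P[/eqP ? /eqP ? /eqP ? /eqP ?].
by apply/eqP/rV4P; rewrite mxE.
Qed.

(** * The addition and doubling identities of f *)

(** Let N and D be the square roots of the T and Z coordinates of P + Q, and
    N0 and D those of Q - P, all by the first law; put M = T2 Z1 - T1 Z2.  Then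
    N N0 = M D on the curve, from which
      D (a2 b1 - a1 b2) = N0 (D^2 - s N^2),
      D (a2 b1 + a1 b2) = N (D^2 - s N0^2),
    where a and b are the numerator and denominator of f; the product of the
    two lines is the claim up to a power of D.  When Q - P comes from the dual
    law, the pair (N0, D) is replaced by the proportional pair (M, N).  In both
    cases the cofactor is the square of the Z coordinate of Q - P. *)
Lemma jq_f_num_add_sub (F : fieldType) (delta s : F) (P Q : 'rV[F]_4) :
    on_jacobi_quartic (s ^+ 2) delta P -> on_jacobi_quartic (s ^+ 2) delta Q ->
  let S := jq_law (s ^+ 2) delta P Q in
  let R := jq_add (s ^+ 2) delta Q (jq_opp P) in
  jq_f_num s S * jq_f_num s R =
    R 0 iZ ^+ 2 * ((jq_f_num s Q * jq_f_den s P) ^+ 2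
                   - (jq_f_num s P * jq_f_den s Q) ^+ 2).
Proof.
case/and3P=> _ /eqP hX1 /eqP hY1 /and3P[_ /eqP hX2 /eqP hY2].
rewrite /jq_add /jq_law /jq_law_dual /jq_opp /jq_f_num /jq_f_den /=.
case: ifP => _; rewrite !hpointE; move: hX1 hY1 hX2 hY2.
all: move: (P 0 iX) (P 0 iY) (P 0 iT) (P 0 iZ) => X1 Y1 T1 Z1.
all: move: (Q 0 iX) (Q 0 iY) (Q 0 iT) (Q 0 iZ) => X2 Y2 T2 Z2.
all: move=> hX1 hY1 hX2 hY2; rewrite hX1 in hY1; rewrite hX2 in hY2.
all: ring: hX1 hX2 hY1 hY2.
Qed.

(** With the same notation, Y3 and Y0 being the second coordinates of P + Q and
    Q - P, the factors are
      Y3 (D^2 + s N0^2) = D^2 (b1 b2 + kappa a1 a2),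
      Y0 (D^2 + s N^2) = D^2 (b1 b2 - kappa a1 a2). *)
Lemma jq_f_den_add_sub (F : fieldType) (delta s : F) (P Q : 'rV[F]_4) :
    on_jacobi_quartic (s ^+ 2) delta P -> on_jacobi_quartic (s ^+ 2) delta Q ->
  let S := jq_law (s ^+ 2) delta P Q in
  let R := jq_add (s ^+ 2) delta Q (jq_opp P) in
  jq_f_den s S * jq_f_den s R =
    R 0 iZ ^+ 2 * ((jq_f_den s P * jq_f_den s Q) ^+ 2
                   - (2 * (delta - s) * jq_f_num s P * jq_f_num s Q) ^+ 2).
Proof.
case/and3P=> _ /eqP hX1 /eqP hY1 /and3P[_ /eqP hX2 /eqP hY2].
rewrite /jq_add /jq_law /jq_law_dual /jq_opp /jq_f_num /jq_f_den /=.
case: ifP => _; rewrite !hpointE; move: hX1 hY1 hX2 hY2.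
all: move: (P 0 iX) (P 0 iY) (P 0 iT) (P 0 iZ) => X1 Y1 T1 Z1.
all: move: (Q 0 iX) (Q 0 iY) (Q 0 iT) (Q 0 iZ) => X2 Y2 T2 Z2.
all: move=> hX1 hY1 hX2 hY2; rewrite hX1 in hY1; rewrite hX2 in hY2.
all: ring: hX1 hX2 hY1 hY2.
Qed.

(** If N = D = 0 in the notation above, then the X coordinate of Q - P, which is
    N0 D or M N, vanishes as well.  So the first law can only fail at (P, Q)
    when w(Q - P) = 0, which the differential addition formula excludes. *)
Lemma jq_law_neq0 (F : fieldType) (eps delta : F) (P Q : 'rV[F]_4) :
  jq_add eps delta Q (jq_opp P) 0 iX != 0 -> jq_law eps delta P Q != 0.
Proof.
apply: contraNneq => /eqP; rewrite {1}/jq_law hpoint_eq0 !sqrf_eq0.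
case/and4P=> _ _ /eqP hN /eqP hD; apply/eqP.
rewrite /jq_add /jq_law /jq_law_dual /jq_opp !hpointE.
case: ifP => _; rewrite !hpointE.
  by rewrite [X in _ * X](_ : _ = 0) ?mulr0 // -hD; ring.
by rewrite [X in _ * X](_ : _ = 0) ?mulr0 // -hN; ring.
Qed.

(** Here c plays the role of g, as c = jq_f_den^2 g. *)
Lemma jq_f_num_double (F : fieldType) (delta s : F) (P : 'rV[F]_4) :
    on_jacobi_quartic (s ^+ 2) delta P ->
  exists2 c, jq_f_num s (jq_law (s ^+ 2) delta P P)
               = 2 * jq_f_num s P * jq_f_den s P * c
    & c ^+ 2 = (2 * (delta - s) * jq_f_num s P ^+ 2 + jq_f_den s P ^+ 2) ^+ 2
               - 8 * (delta + s) * (jq_f_num s P * jq_f_den s P) ^+ 2.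
Proof.
case/and3P=> _ /eqP hX /eqP hY.
(* This is D^2 - s N^2, where N = 2 X Y and D = Z^2 - s^2 T^2 are the square
   roots of the T and Z coordinates of 2P, so that the numerator of f(2P) is
   N D (D^2 - s N^2) with N D = 2 jq_f_num jq_f_den. *)
exists ((P 0 iZ ^+ 2 - s ^+ 2 * P 0 iT ^+ 2) ^+ 2
        - 4 * s * P 0 iX ^+ 2 * P 0 iY ^+ 2);
  rewrite /jq_law /jq_f_num /jq_f_den ?hpointE; move: hX hY.
all: move: (P 0 iX) (P 0 iY) (P 0 iT) (P 0 iZ) => X Y T Z hX hY.
all: rewrite hX in hY; ring: hX hY.
Qed.

Lemma jq_f_den_double (F : fieldType) (delta s : F) (P : 'rV[F]_4) :
    on_jacobi_quartic (s ^+ 2) delta P ->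
  jq_f_den s (jq_law (s ^+ 2) delta P P) =
    jq_f_den s P ^+ 4 - (2 * (delta - s) * jq_f_num s P ^+ 2) ^+ 2.
Proof.
case/and3P=> _ /eqP hX /eqP hY.
rewrite /jq_law /jq_f_num /jq_f_den !hpointE; move: hX hY.
move: (P 0 iX) (P 0 iY) (P 0 iT) (P 0 iZ) => X Y T Z hX hY.
by rewrite hX in hY; ring: hX hY.
Qed.

(** * The values of w and its doubling and addition formulas *)

Section OddNonsingular.
Variables (F : fieldType) (delta s : F).
Hypotheses (odd_char : 2%N \notin [pchar F])
  (nonsingular : s ^+ 2 * (delta ^+ 2 - s ^+ 2) != 0).
Implicit Types P Q : 'rV[F]_4.

Local Notation on_curve := (on_jacobi_quartic (s ^+ 2) delta).
Local Notation add := (jq_add (s ^+ 2) delta).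
Local Notation value := (ratfun_value (s ^+ 2) delta (jq_w delta s)).
Local Notation kappa := (2 * (delta - s)).

Lemma nonsingular_factors : [/\ s != 0, delta - s != 0 & delta + s != 0].
Proof.
move: nonsingular; rewrite subr_sqr !mulf_eq0 !negb_or andbb.
by case/and3P.
Qed.

Lemma kappa_neq0 : kappa != 0.
Proof.
by have [_ ds _] := nonsingular_factors; apply: mulf_neq0 (two_neq0 odd_char) ds.
Qed.

(** The dual law vanishes on the diagonal and the two laws never vanish
    together, so the first one always computes 2P. *)
Lemma jq_add_self P : on_curve P -> add P P = jq_law (s ^+ 2) delta P P.
Proof.
move=> onP; have /and3P[nz _ _] := jq_add_on odd_char nonsingular onP onP.
move: nz; rewrite /jq_add; case: ifP => // _ /eqP[].
case/and3P: onP => _ /eqP hX /eqP hY.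
apply: rV4P; rewrite /jq_law_dual !hpointE mxE; try ring.
by move: hX hY => hX hY; rewrite hX in hY; ring: hX hY.
Qed.

(** A common zero has X = 0 or Z = s T, and Y = 0 or Z = - s T; the equations of
    the curve turn each of the four cases into T = 0, which forces all
    coordinates to vanish.  In the case Y = 0, Z = s T one gets
    2 s (delta + s) T^2 = 0, where nonsingularity comes in. *)
Lemma jq_f_neq00 P :
  on_curve P -> (jq_f_num s P, jq_f_den s P) != (0, 0).
Proof.
have [s0 _ sd] := nonsingular_factors; have n2 := two_neq0 odd_char.
case/and3P=> + /eqP hX /eqP hY; apply: contraNneq => -[] /eqP hnum /eqP hden.
rewrite /jq_f_num /jq_f_den !mulf_eq0 in hnum hden.
have T0 : P 0 iT = 0.
  apply/eqP; case/orP: hnum => [/eqP X0|]; last rewrite subr_eq0 => /eqP ZE.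
    have TZ : P 0 iT * P 0 iZ == 0 by rewrite -hX X0 expr0n.
    case/orP: hden => [/eqP Y0|]; last first.
      rewrite addr_eq0 => /eqP ZE; move: TZ.
      by rewrite ZE mulrN oppr_eq0 !mulf_eq0 (negPf s0) /= orbb.
    move: TZ; rewrite mulf_eq0 => /orP[//|/eqP Z0].
    have : (s * P 0 iT) ^+ 2 == 0.
      rewrite (_ : _ ^+ 2 = P 0 iY ^+ 2 - 2 * delta * P 0 iX ^+ 2 - P 0 iZ ^+ 2).
        by rewrite X0 Y0 Z0 expr0n /= mulr0 !subr0.
      by rewrite hY; ring.
    by rewrite sqrf_eq0 mulf_eq0 (negPf s0).
  have : 2 * s * P 0 iT == 0 \/ 2 * s * (delta + s) * P 0 iT ^+ 2 == 0.
    case/orP: hden => [/eqP Y0|]; [right | rewrite ZE => h; left].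
      rewrite (_ : _ * _ = P 0 iY ^+ 2); first by rewrite Y0 expr0n.
      by rewrite hY hX ZE; ring.
    by rewrite (_ : 2 * s * _ = s * P 0 iT + s * P 0 iT) //; ring.
  by case; rewrite ?expr2 !mulf_eq0 (negPf n2) (negPf s0) ?(negPf sd) ?orbb.
have X0 : P 0 iX = 0 by apply/eqP; rewrite -sqrf_eq0 hX T0 mul0r.
have YZ : P 0 iY ^+ 2 = P 0 iZ ^+ 2 by rewrite hY X0 T0; ring.
have Z0 : P 0 iZ = 0.
  apply/eqP; rewrite -sqrf_eq0 -YZ sqrf_eq0; move: hden.
  rewrite T0 mulr0 addr0 => /orP[//|/eqP Z0].
  by rewrite -sqrf_eq0 YZ Z0 expr0n.
have Y0 : P 0 iY = 0 by apply/eqP; rewrite -sqrf_eq0 YZ Z0 expr0n.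
by apply/eqP/rV4P; rewrite mxE.
Qed.

Lemma jq_w_value P v :
    on_curve P -> value P v ->
  proj1_eq v (kappa * jq_f_num s P ^+ 2, jq_f_den s P ^+ 2).
Proof.
move=> onP hv; have [hom1 hom2] := jq_w_homog delta s.
have := ratfun_value_base_point_free hom1 hom2 onP _ hv.
rewrite jq_w_num jq_w_den; apply.
apply: contraNneq (jq_f_neq00 onP) => -[/eqP + /eqP].
by rewrite mulf_eq0 (negPf kappa_neq0) !sqrf_eq0 => /eqP-> /eqP->.
Qed.

Lemma jq_w_doubling P W1 Z1 W4 Z4 :
    on_curve P -> value P (W1, Z1) -> value (add P P) (W4, Z4) ->
  proj1_eq (W4, Z4)
    (4 * W1 * Z1 * ((W1 + Z1) ^+ 2 - 4 * (delta + s) / (delta - s) * W1 * Z1),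
     (W1 ^+ 2 - Z1 ^+ 2) ^+ 2).
Proof.
move=> onP /(jq_w_value onP)/proj1_eq_scale[l1 l10 [-> ->]].
have onPP := jq_add_on odd_char nonsingular onP onP.
move/(jq_w_value onPP)/proj1_eq_scale=> [l4 l40 [-> ->]].
have := jq_f_neq00 onPP; rewrite jq_add_self //.
have [c -> cE] := jq_f_num_double onP.
have -> := jq_f_den_double onP.
have [_ ds _] := nonsingular_factors.
move: (jq_f_num s P) (jq_f_den s P) cE => a b cE nz.
(* The two coordinates on the right of the formula are, up to the common factor
   l1^4, exactly the numerator and the denominator of w at 2P. *)
have -> : 4 * (l1 * (kappa * a ^+ 2)) * (l1 * b ^+ 2) *
    ((l1 * (kappa * a ^+ 2) + l1 * b ^+ 2) ^+ 2 - 4 * (delta + s) / (delta - s)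
     * (l1 * (kappa * a ^+ 2)) * (l1 * b ^+ 2))
    = l1 ^+ 4 * (kappa * (2 * a * b * c) ^+ 2).
  rewrite !exprMn cE; field; exact: ds.
have -> : ((l1 * (kappa * a ^+ 2)) ^+ 2 - (l1 * b ^+ 2) ^+ 2) ^+ 2
    = l1 ^+ 4 * (b ^+ 4 - (kappa * a ^+ 2) ^+ 2) ^+ 2 by ring.
move: (2 * a * b * c) (_ - _) nz => a4 b4 nz.
have kn := kappa_neq0.
split=> /=; [exact: sq_pair_neq0 | | by ring].
by apply: sq_pair_neq0 => //; rewrite expf_neq0.
Qed.

Lemma jq_w_diff_addition P Q W0 Z0 W1 Z1 W2 Z2 W3 Z3 :
    on_curve P -> on_curve Q -> value (add Q (jq_opp P)) (W0, Z0) ->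
    value P (W1, Z1) -> value Q (W2, Z2) -> value (add P Q) (W3, Z3) ->
    W0 * Z0 != 0 ->
  proj1_eq (W3, Z3)
    (Z0 * (W1 * Z2 - W2 * Z1) ^+ 2, W0 * (W1 * W2 - Z1 * Z2) ^+ 2).
Proof.
move=> onP onQ.
have onR := jq_add_on odd_char nonsingular onQ (jq_opp_on onP).
have onS := jq_add_on odd_char nonsingular onP onQ.
move/(jq_w_value onR)/proj1_eq_scale=> [l0 l0n [-> ->]].
move/(jq_w_value onP)/proj1_eq_scale=> [l1 l1n [-> ->]].
move/(jq_w_value onQ)/proj1_eq_scale=> [l2 l2n [-> ->]].
move/(jq_w_value onS)/proj1_eq_scale=> [l3 l3n [-> ->]].
move=> h0; have [a0n b0n] : jq_f_num s (add Q (jq_opp P)) != 0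
    /\ jq_f_den s (add Q (jq_opp P)) != 0.
  by split; apply: contraNneq h0 => ->; rewrite expr0n /= !(mulr0, mul0r).
have Sn0 : jq_law (s ^+ 2) delta P Q != 0.
  apply: jq_law_neq0; apply: contraNneq a0n => h.
  by rewrite /jq_f_num h mul0r.
have SE : add P Q = jq_law (s ^+ 2) delta P Q by rewrite /jq_add ifT.
have := jq_f_neq00 onS; rewrite SE.
have /= := jq_f_num_add_sub onP onQ.
have /= := jq_f_den_add_sub onP onQ.
move: (add Q (jq_opp P) 0 iZ ^+ 2) => c.
move: (jq_law _ _ _ _) (add Q (jq_opp P)) a0n b0n => S R.
move: (jq_f_num s P) (jq_f_num s Q) (jq_f_num s R) (jq_f_num s S).
move: (jq_f_den s P) (jq_f_den s Q) (jq_f_den s R) (jq_f_den s S).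
move=> b1 b2 b0 b3 a1 a2 a0 a3 a0n b0n /= hb ha nz.
have kn := kappa_neq0.
move: kappa kn hb => k kn hb.
(* The two coordinates on the right of the formula involve the squares of A and
   B, where f(P+Q) f(Q-P) = A / B. *)
set A := _ - (a1 * b2) ^+ 2 in ha; set B := _ - _ ^+ 2 in hb.
have EA : (l1 * (k * a1 ^+ 2) * (l2 * b2 ^+ 2) -
   l2 * (k * a2 ^+ 2) * (l1 * b1 ^+ 2)) ^+ 2 = (l1 * l2 * k * A) ^+ 2.
  by rewrite /A; ring.
have EB : (l1 * (k * a1 ^+ 2) * (l2 * (k * a2 ^+ 2)) -
   l1 * b1 ^+ 2 * (l2 * b2 ^+ 2)) ^+ 2 = (l1 * l2 * B) ^+ 2.
  by rewrite /B; ring.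
rewrite EA EB; split=> /=; first exact: sq_pair_neq0.
  (* If A = B = 0, both forms vanish at P + Q, as neither vanishes at Q - P. *)
  apply: contraNneq nz => /eqP; rewrite xpair_eqE !mulf_eq0 !orbb.
  rewrite (negPf l0n) (negPf l1n) (negPf l2n) (negPf kn) (negPf a0n).
  rewrite (negPf b0n) /= => /andP[/eqP A0 /eqP B0].
  move: ha hb; rewrite A0 B0 mulr0 => /eqP + /eqP.
  by rewrite !mulf_eq0 (negPf a0n) (negPf b0n) !orbF => /eqP-> /eqP->.
have -> : l3 * (k * a3 ^+ 2) * (l0 * (k * a0 ^+ 2) * (l1 * l2 * B) ^+ 2)
    = l0 * l3 * (l1 * l2 * k) ^+ 2 * ((a3 * a0) * B) ^+ 2 by ring.
rewrite ha.
have -> : l0 * b0 ^+ 2 * (l1 * l2 * k * A) ^+ 2 * (l3 * b3 ^+ 2)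
    = l0 * l3 * (l1 * l2 * k) ^+ 2 * ((b3 * b0) * A) ^+ 2 by ring.
by rewrite hb; ring.
Qed.

End OddNonsingular.

Theorem proposition9 (F : finFieldType) (eps delta s : F)
    (odd_char : 2%N \notin [pchar F])
    (nonsingular : eps * (delta ^+ 2 - eps) != 0)
    (chi_eps : quadratic_char eps = 1)
    (sqrt_eps : s ^+ 2 = eps) :
  inverted_montgomery_like eps delta (jq_w delta s)
    (4 * (delta + s) / (delta - s)).
Proof.
move: nonsingular; rewrite -sqrt_eps => nonsingular.
split.
- split; first by exists 4; exact: jq_w_homog.
  (* The denominator is 1 at the point (0, 1), so it is not in the ideal. *)
  have onO : on_jacobi_quartic (s ^+ 2) delta (jq_zero F).
    rewrite /on_jacobi_quartic /jq_zero !hpointE hpoint_eq0 oner_eq0 !andbF /=.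
    by rewrite !(expr0n, mulr0, add0r, mul0r, expr1n) !eqxx.
  move/jq_ideal_eval0/(_ onO)/eqP; apply/negP.
  rewrite jq_w_den /jq_f_den /jq_zero !hpointE mulr0 addr0 mulr1 expr1n.
  exact: oner_neq0.
- move=> K f P u v /=; rewrite map_jq_w rmorphXn => onP.
  have charK : 2%N \notin [pchar K] by rewrite (fmorph_pchar f).
  have nsK : f s ^+ 2 * (f delta ^+ 2 - f s ^+ 2) != 0.
    by rewrite -!rmorphXn -rmorphB -rmorphM fmorph_eq0.
  have onN := jq_opp_on onP.
  move=> /(jq_w_value charK nsK onP) hu /(jq_w_value charK nsK onN) hv.
  have numN : jq_f_num (f s) (jq_opp P) ^+ 2 = jq_f_num (f s) P ^+ 2.
    by rewrite /jq_f_num /jq_opp !hpointE mulNr sqrrN.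
  have denN : jq_f_den (f s) (jq_opp P) = jq_f_den (f s) P.
    by rewrite /jq_f_den /jq_opp !hpointE.
  by rewrite numN denN in hv; apply: proj1_eq_common hu hv.
- move=> P1 P2 W0 Z0 W1 Z1 W2 Z2 W3 Z3 W4 Z4 add value onP1 onP2.
  move=> v0 v1 v2 v3 v4 h.
  split; first exact: jq_w_doubling v1 v4.
  exact: jq_w_diff_addition v0 v1 v2 v3 h.
Qed.
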